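(* For a long curve $L$ with index $i$ and parameters $x_1,\dots,x_{15}$, let $$\begin{aligned}LI_3(L;x_1,\dots,x_{15})=\big\langle\, & x_1XYXYZZ+x_2XYXZZY+x_3XYZZXY+x_4XYYZXZ+x_5XXYZYZ\\&+x_6XYZYZX+x_7XYYXZZ+x_8XXYZZY+x_9XYZZYX+x_{10}XYZYXZ\\&+x_{11}XYXZYZ+x_{12}XYZXZY+x_{13}XYZXYZ+x_{14}XXYYZZ+x_{15}XYYZZX,\; w_L\big\rangle+i .\end{aligned}$$ Then $LI_3$ is an invariant of long curves, i.e. it is unchanged under plane isotopy of long curves.
   Context: A long curve is an oriented immersion $\mathbf{R}\to\mathbf{R}^2$ whose only singular points are transversal double points, coinciding with the $x$-axis (directed from $-\infty$ to $+\infty$) outside a compact set; plane isotopies are ambient isotopies with compact support. The index $i$ is the number of counterclockwise full turns of the tangent vector. The word $w_L$ is obtained by labelling the double points by distinct letters and reading the labels along $L$ starting from $-\infty$. If $t_1,t_2$ are the tangent vectors at a double point $A$ on the first and second passage, $\mathrm{sign}\,A=+1$ if $(t_1,t_2)$ is a negatively oriented frame, $-1$ otherwise. For a word $v$ in which each letter occurs twice, $\langle v,w_L\rangle=\sum_{v'}\prod_{A\in v'}\mathrm{sign}\,A$, the sum over sub-words $v'$ of $w_L$ (choose a subset of letters, delete the others) equal to $v$ up to bijective renaming of letters, the product over the distinct letters of $v'$; extend linearly in $v$. *)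

(* Defs.v *)
From HB Require Import structures.
From mathcomp Require Import all_boot all_order all_algebra.
From mathcomp Require Import finmap.
From mathcomp Require Import all_classical all_reals all_analysis.

Set Implicit Arguments.
Unset Strict Implicit.
Unset Printing Implicit Defensive.

Import Order.TTheory GRing.Theory Num.Theory.
Import numFieldNormedType.Exports.

Local Open Scope ring_scope.
Local Open Scope classical_set_scope.

Definition det2 (R : realType) (u v : R * R) : R := u.1 * v.2 - u.2 * v.1.

(* Regularity is C^1 throughout: the weakest class in which immersions,
   transversality and the turning of the tangent vector make sense. *)

(* The parametrization of the ends is left free: near the two ends of the
   parameter line the curve runs along the x-axis, rightwards, and it exhausts
   both ends of the axis. *)
Record long_curve (R : realType) (L : R -> R * R) : Prop := LongCurve {
  long_curve_derivable : forall t, derivable L t 1;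
  long_curve_C1 : continuous L^`();
  long_curve_immersion : forall t, L^`() t != 0;
  long_curve_transversal :
    forall s t, s != t -> L s = L t -> det2 (L^`() s) (L^`() t) != 0;
  long_curve_no_triple :
    forall s t u, L s = L t -> L t = L u -> [\/ s = t, t = u | s = u];
  long_curve_axis_left : \forall t \near -oo, (L t).2 = 0 /\ 0 < (L^`() t).1;
  long_curve_axis_right : \forall t \near +oo, (L t).2 = 0 /\ 0 < (L^`() t).1;
  long_curve_left_end : (fun t => (L t).1) @ -oo --> -oo;
  long_curve_right_end : (fun t => (L t).1) @ +oo --> +oo
}.

Definition is_tangent_angle (R : realType) (L : R -> R * R) (theta : R -> R) :=
  continuous theta /\
  forall t, exists2 r : R, 0 < r &
    L^`() t = (r * cos (theta t), r * sin (theta t)).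

Definition is_index (R : realType) (L : R -> R * R) (i : int) :=
  exists2 theta : R -> R, is_tangent_angle L theta &
    (fun t => theta t - theta (- t)) @ +oo --> i%:~R * (2 * pi).

(* For a long curve there is exactly one [i] such that [is_index L i]; the
   default value 0 is never used. *)
Definition curve_index (R : realType) (L : R -> R * R) : int :=
  xget 0 [set i | is_index L i].

Definition double_params (R : realType) (L : R -> R * R) : set R :=
  [set s | exists2 t, t != s & L t = L s].

(* The label of a double point is the double point itself. For a long curve
   [double_params L] is finite, by transversality and compactness, so that
   [fset_set] does return its elements. *)
Definition gauss_word (R : realType) (L : R -> R * R) : seq (R * R) :=
  [seq L s | s <- sort <=%R (fset_set (double_params L))].

Definition double_point_sign (R : realType) (L : R -> R * R) (A : R * R) : int :=
  if `[< exists s t, [/\ s < t, L s = A, L t = A &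
                         det2 (L^`() s) (L^`() t) < 0] >] then 1 else -1.

Definition same_word (T U : eqType) (v : seq T) (w : seq U) : Prop :=
  exists2 f : T -> U, {in v &, injective f} & w = [seq f a | a <- v].

Definition word_pairing (T : eqType) (U : choiceType) (sgn : U -> int)
    (v : seq T) (w : seq U) : int :=
  \sum_(S <- fpowerset [fset a in w]%fset |
        `[< same_word v [seq a <- w | a \in S] >])
    \prod_(a <- S) sgn a.

Definition pairing (K : comNzRingType) (T : eqType) (R : realType)
    (c : seq (K * seq T)) (L : R -> R * R) : K :=
  \sum_(cv <- c)
    cv.1 * (word_pairing (double_point_sign L) cv.2 (gauss_word L))%:~R.

Definition LI3 (K : comNzRingType) (R : realType) (L : R -> R * R)
    (x1 x2 x3 x4 x5 x6 x7 x8 x9 x10 x11 x12 x13 x14 x15 : K) : K :=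
  let X := 0%N in let Y := 1%N in let Z := 2%N in
  pairing
    [:: (x1,  [:: X; Y; X; Y; Z; Z]);
        (x2,  [:: X; Y; X; Z; Z; Y]);
        (x3,  [:: X; Y; Z; Z; X; Y]);
        (x4,  [:: X; Y; Y; Z; X; Z]);
        (x5,  [:: X; X; Y; Z; Y; Z]);
        (x6,  [:: X; Y; Z; Y; Z; X]);
        (x7,  [:: X; Y; Y; X; Z; Z]);
        (x8,  [:: X; X; Y; Z; Z; Y]);
        (x9,  [:: X; Y; Z; Z; Y; X]);
        (x10, [:: X; Y; Z; Y; X; Z]);
        (x11, [:: X; Y; X; Z; Y; Z]);
        (x12, [:: X; Y; Z; X; Z; Y]);
        (x13, [:: X; Y; Z; X; Y; Z]);
        (x14, [:: X; X; Y; Y; Z; Z]);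
        (x15, [:: X; Y; Y; Z; Z; X])] L
  + (curve_index L)%:~R.

Definition C1_map (R : realType) (f : R * R -> R * R) :=
  (forall p, differentiable f p) /\ (forall v, continuous ('D_v f)).

Definition C1_diffeo (R : realType) (f : R * R -> R * R) :=
  exists g : R * R -> R * R, [/\ cancel f g, cancel g f, C1_map f & C1_map g].

Record ambient_isotopy (R : realType) (phi : R -> R * R -> R * R) : Prop :=
  AmbientIsotopy {
  isotopy_start : phi 0 = id;
  isotopy_diffeo : forall t, 0 <= t <= 1 -> C1_diffeo (phi t);
  isotopy_continuous :
    {within `[0, 1] `*` setT, continuous (fun z : R * (R * R) => phi z.1 z.2)};
  isotopy_continuous_deriv : forall v,
    {within `[0, 1] `*` setT,
      continuous (fun z : R * (R * R) => 'D_v (phi z.1) z.2)};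
  isotopy_support : exists2 K : set (R * R), compact K &
    forall t p, 0 <= t <= 1 -> ~ K p -> phi t p = p
}.

Definition reparametrization (R : realType) (rho : R -> R) :=
  [/\ bijective rho, forall t, derivable rho t 1, continuous rho^`() &
      forall t, 0 < rho^`() t].

(* Curves are only oriented, so the image curve may be parametrized anew. *)
Definition plane_isotopic (R : realType) (L L' : R -> R * R) :=
  exists (phi : R -> R * R -> R * R) (rho : R -> R),
    [/\ ambient_isotopy phi, reparametrization rho &
        forall t, phi 1 (L t) = L' (rho t)].

(* Main.v *)
Require Import Defs.
From mathcomp Require Import all_boot all_order all_algebra finmap ring lra.
From mathcomp Require Import all_classical all_reals all_analysis.

Set Implicit Arguments.
Unset Strict Implicit.
Unset Printing Implicit Defensive.

Import Order.TTheory GRing.Theory Num.Theory.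
Import numFieldNormedType.Exports.

Local Open Scope ring_scope.
Local Open Scope classical_set_scope.

(** An ambient isotopy creates and destroys no double point, so the two halves
    of [LI3] are invariant separately.

    The pairing. If [psi] is the final diffeomorphism of the isotopy and [rho]
    the change of parameter, then [L' \o rho = psi \o L]. Hence [rho] carries
    the double parameters of [L] onto those of [L'] in the same order, and the
    Gauss word of [L'] is that of [L] with its letters renamed by [psi]
    ([gauss_word_conj]). The pairing only sees words up to renaming
    ([word_pairing_map]), provided that signs are kept. They are: [psi]
    multiplies the frame of tangents at a double point by its Jacobian, which
    is positive because along the isotopy the Jacobian never vanishes and
    starts at 1 ([isotopy_jacobian_gt0]).

    The index. At time [t] of the isotopy, [push_tangent phi L t] is the field of
    tangents of the moved curve, seen in the parameter of [L]. These fields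
    depend continuously on [t], never vanish, and all agree with [L^`()] outside
    a bounded interval of parameters. By compactness of that interval, fields at
    nearby times point everywhere in directions less than a right angle apart
    ([push_tangent_close]). The angle between two such fields is the arctangent
    of the ratio of determinant and scalar product, a continuous function which
    vanishes near both ends; adding it to an angle function of one field gives
    an angle function of the other with the same total variation
    ([turns_close]). The total turning is thus locally constant in [t], hence
    constant. Finally the field at time 1 is, up to a positive factor and the
    change of parameter, the tangent field of [L'].

    The definition of the index compares the angle at [t] and at [- t], which is
    not stable under a change of parameter. For a long curve the angle is
    constant near each end, so the index is the difference of the limits of the
    angle at both ends ([is_index_turns]), and this is stable. *)

(** * Gauss words under relabelling *)

(** The inverse [g'] serves to rename the letters of [map g w] back to those of
    [w]; injectivity of [g] would not suffice when [v] and [w] are empty, as a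
    renaming is a total function and needs a value in [U]. *)
Lemma same_word_map (T U W : eqType) (g : U -> W) (g' : W -> U)
    (v : seq T) (w : seq U) :
  cancel g g' -> cancel g' g -> same_word v (map g w) <-> same_word v w.
Proof.
move=> gK g'K; split=> [[f finj wE]|[f finj ->]]; last first.
  exists (g \o f); last by rewrite -map_comp.
  by move=> a b av bv /= /(can_inj gK); exact: finj.
exists (g' \o f); last by rewrite (map_comp g' f) -[map f v]wE mapK.
by move=> a b av bv /= /(can_inj g'K); exact: finj.
Qed.

(** Taking images by [g] is a bijection between the subsets of letters of [w]
    and those of [map g w], and it preserves each term of the pairing. *)
Lemma word_pairing_map (T : eqType) (U W : choiceType) (g : U -> W)
    (g' : W -> U) (sU : U -> int) (sW : W -> int) (v : seq T) (w : seq U) :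
  cancel g g' -> cancel g' g -> (forall a, sW (g a) = sU a) ->
  word_pairing sW v (map g w) = word_pairing sU v w.
Proof.
move=> gK g'K sE; rewrite /word_pairing.
have memg (S : {fset U}) a : (g a \in (g @` S)%fset) = (a \in S).
  by rewrite mem_imfset //; exact: can_inj gK.
have memg' (S : {fset W}) a : (g' a \in (g' @` S)%fset) = (a \in S).
  by rewrite mem_imfset //; exact: can_inj g'K.
have imK (S : {fset U}) : (g' @` (g @` S))%fset = S.
  by apply/fsetP=> a; rewrite -{1}(gK a) memg' memg.
have imK' (S : {fset W}) : (g @` (g' @` S))%fset = S.
  by apply/fsetP=> a; rewrite -{1}(g'K a) memg memg'.
have -> : fpowerset [fset b in map g w]%fset =
    ((fun S : {fset U} => g @` S) @` fpowerset [fset a in w])%fset.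
  have sub (S : {fset U}) :
      ((g @` S)%fset `<=` [fset b in map g w])%fset =
      (S `<=` [fset a in w])%fset.
    apply/fsubsetP/fsubsetP => SS a.
      move=> aS; have := SS (g a).
      by rewrite memg !inE mem_map; [exact|exact: can_inj gK].
    rewrite -{1 2}(g'K a) memg => /SS; rewrite !inE mem_map//; exact: can_inj gK.
  apply/fsetP=> S; rewrite fpowersetE; apply/idP/imfsetP => /= [SS|[S' + ->]].
    by exists (g' @` S)%fset; rewrite ?fpowersetE -?sub imK'.
  by rewrite fpowersetE sub.
rewrite big_mkcond [RHS]big_mkcond big_imfset /=; last first.
  by move=> S S' _ _ /(congr1 (fun S : {fset W} => g' @` S)%fset); rewrite !imK.
apply: eq_bigr => S _; rewrite big_imfset /=; last first.
  by move=> a b _ _; exact: (can_inj gK).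
rewrite (eq_bigr _ (fun a _ => sE a)); congr (if _ then _ else _).
rewrite filter_map; under eq_filter => a do rewrite /= memg.
exact/asbool_equiv_eq/(same_word_map _ _ gK g'K).
Qed.

(** * Gauss words of conjugate curves *)

Lemma double_params_conj (R : realType) (psi : R * R -> R * R)
    (rho rho' : R -> R) (L L' : R -> R * R) :
  injective psi -> cancel rho rho' -> cancel rho' rho ->
  (forall t, L' (rho t) = psi (L t)) ->
  double_params L' = rho @` double_params L.
Proof.
move=> psiI rhoK rho'K LE; apply/seteqP.
split=> [s [t ts Lts]|_ [s [t ts Lts] <-]].
  exists (rho' s); last exact: rho'K.
  exists (rho' t); first by rewrite (can_eq rho'K).
  by apply: psiI; rewrite -!LE !rho'K.
by exists (rho t); [rewrite (can_eq rhoK)|rewrite !LE Lts].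
Qed.

Lemma gauss_word_conj (R : realType) (psi : R * R -> R * R)
    (rho rho' : R -> R) (L L' : R -> R * R) :
  injective psi -> cancel rho rho' -> cancel rho' rho ->
  {mono rho : s t / s <= t} ->
  (forall t, L' (rho t) = psi (L t)) ->
  gauss_word L' = map psi (gauss_word L).
Proof.
move=> psiI rhoK rho'K rho_mono LE.
rewrite /gauss_word (double_params_conj psiI rhoK rho'K LE).
have -> : fset_set (rho @` double_params L) =
    (rho @` fset_set (double_params L))%fset.
  have [fin|inf] := pselect (finite_set (double_params L)).
    exact: fset_set_image.
  have inf' : ~ finite_set (rho @` double_params L).
    move=> /(finite_image rho'); rewrite image_comp (_ : rho' \o rho = id).
      by rewrite image_id.
    exact/funext.
  (* Both words are then empty, as [fset_set] sends infinite sets to [fset0]. *)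
  rewrite /fset_set; case: pselect => //; case: pselect => // *.
  by rewrite imfset0.
set D := fset_set (double_params L).
have -> : sort <=%R (rho @` D)%fset = sort <=%R (map rho D).
  apply/(perm_sortP le_total le_trans le_anti)/uniq_perm.
  - exact: fset_uniq.
  - by rewrite map_inj_uniq ?fset_uniq//; exact: can_inj rhoK.
  - by move=> b; apply/imfsetP/mapP => -[a]; exists a.
rewrite (homo_sort_map (leT := <=%R)).
- by rewrite -!map_comp; apply: eq_map => s /=.
- by move=> s t /le_anti/(can_inj rhoK).
- by move=> s t u /=; exact: le_trans.
- exact: le_total.
- by move=> s t; rewrite rho_mono.
Qed.

(** * Continuity on the parameter space of the isotopy *)

(** Connectedness of the real line, in the form of the intermediate value
    theorem applied to the indicator function of [P]. *)
Lemma locally_constant_prop (R : realType) (P : R -> Prop) :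
  (forall t0, \forall t \near t0, P t <-> P t0) -> forall s t, P s -> P t.
Proof.
move=> Ploc; pose f t : R := (`[< P t >])%:R.
have fcont : continuous f.
  move=> t0; apply: cvg_near_cst; near=> t.
  rewrite /f; congr (_%:R); congr nat_of_bool; apply: asbool_equiv_eq.
  by near: t; exact: Ploc.
have half c : f c != 2^-1.
  by rewrite /f; case: asboolP => _; apply/eqP => /= h; lra.
have key s t : s <= t -> f s = f t.
  move=> st; apply/eqP/contraT => fst.
  have [|c _ fc] := IVT (v := 2^-1) st (continuous_subspaceT fcont); last first.
    by case/eqP: (half c).
  move: fst; rewrite /f.
  case: (asboolP (P s)) => _; case: (asboolP (P t)) => _;
    rewrite ?eqxx// => _; rewrite ge_min le_max; apply/andP; split; apply/orP => /=;
    first [left; lra|right; lra].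
move=> s t Ps; suff : f s = f t.
  by rewrite /f; case: asboolP => // _; case: asboolP => // _ /= h; lra.
by case: (leP s t) => [/key //|/ltW/key ->].
Unshelve. all: by end_near. Qed.

(** Stopping time outside the unit interval turns continuity within
    [`[0, 1] `*` setT] into continuity on the whole product, and lets time range
    over the connected space [R]. *)
Definition clamp (R : realType) (t : R) : R := Num.max 0 (Num.min 1 t).

Lemma clamp_itv (R : realType) (t : R) : 0 <= clamp t <= 1.
Proof. by rewrite /clamp le_max lexx /= ge_max ler01 ge_min lexx. Qed.

Lemma clamp_id (R : realType) (t : R) : 0 <= t <= 1 -> clamp t = t.
Proof. by case/andP=> t0 t1; rewrite /clamp (min_idPr t1) (max_idPr t0). Qed.

Lemma clamp_continuous (R : realType) : continuous (@clamp R).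
Proof.
move=> t; apply: (@continuous_max R R (cst 0) (Num.min 1)); first exact: cvg_cst.
by apply: (@continuous_min R R (cst 1) id); [exact: cvg_cst|exact: cvg_id].
Qed.

Lemma continuous_clamp (R : realType) (T V : topologicalType) (f : R * T -> V) :
  {within `[0, 1] `*` setT, continuous f} ->
  continuous (fun z : R * T => f (clamp z.1, z.2)).
Proof.
move=> /subspace_continuousP fcont z.
have inA (y : R * T) : (`[0, 1] `*` setT) (clamp y.1, y.2).
  by split => //=; rewrite in_itv/= clamp_itv.
have hcont : (clamp y.1, y.2) @[y --> z] --> (clamp z.1, z.2).
  apply: (@cvg_pair _ _ _ (nbhs z) (nbhs (clamp z.1)) (nbhs z.2)).
    by apply: (@cvg_comp _ _ _ fst (@clamp R) _ (nbhs z.1));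
      [exact: cvg_fst|exact: clamp_continuous].
  exact: cvg_snd.
have hwithin : (clamp y.1, y.2) @[y --> z] -->
    within (`[0, 1] `*` setT) (nbhs (clamp z.1, z.2)).
  by move=> U /hcont; apply: (@filterS _ (nbhs z)) => y; apply; exact: inA.
exact: cvg_comp hwithin (fcont _ (inA z)).
Qed.

Lemma continuous_fst_comp (R : realType) (T : topologicalType) (f : T -> R * R) :
  continuous f -> continuous (fun x => (f x).1).
Proof. by move=> fc s; apply: (cvg_comp f fst (fc s)); exact: cvg_fst. Qed.

Lemma continuous_snd_comp (R : realType) (T : topologicalType) (f : T -> R * R) :
  continuous f -> continuous (fun x => (f x).2).
Proof. by move=> fc s; apply: (cvg_comp f snd (fc s)); exact: cvg_snd. Qed.

(** * Differentials of plane maps *)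

Lemma derive_coord (R : realType) (f : R * R -> R * R) p v :
  differentiable f p ->
  'D_v f p = v.1 *: 'D_(1, 0) f p + v.2 *: 'D_(0, 1) f p.
Proof.
move=> fd; rewrite !deriveE// -!linearZ -linearD; congr ('d f p _).
by apply: injective_projections;
  rewrite /= /GRing.scale/= ?mulr1 ?mulr0 ?addr0 ?add0r.
Qed.

Definition jacobian (R : realType) (f : R * R -> R * R) (p : R * R) : R :=
  det2 ('D_(1, 0) f p) ('D_(0, 1) f p).

Lemma det2_derive (R : realType) (f : R * R -> R * R) p u v :
  differentiable f p ->
  det2 ('D_u f p) ('D_v f p) = jacobian f p * det2 u v.
Proof.
move=> fd; rewrite (derive_coord u fd) (derive_coord v fd) /jacobian.
move: ('D_(1, 0) f p) ('D_(0, 1) f p) u v => [a b] [c d] [u1 u2] [v1 v2].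
by rewrite /det2 /= /GRing.scale /=; ring.
Qed.

(** By the chain rule, the differential of the inverse map is a left inverse of
    the differential of [f]. *)
Lemma diffeo_derive_eq0 (R : realType) (f : R * R -> R * R) p v :
  C1_diffeo f -> 'D_v f p = 0 -> v = 0.
Proof.
case=> g [fK _ [fd _] [gd _]]; rewrite deriveE// => fv0.
have -> : v = 'd (g \o f) p v.
  have -> : g \o f = id by apply/funext => q; exact: fK.
  by rewrite diff_val.
have h := diff_comp (fd p) (gd (f p)).
rewrite [LHS](congr1 (fun h => h v) h).
exact: etrans (congr1 ('d g (f p)) fv0) (linear0 _).
Qed.

Lemma diffeo_jacobian_neq0 (R : realType) (f : R * R -> R * R) p :
  C1_diffeo f -> jacobian f p != 0.
Proof.
move=> fdiff; have [_ [_ _ [fd _] _]] := fdiff.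
apply/eqP => J0.
set u := 'D_(1, 0) f p; set v := 'D_(0, 1) f p.
have ker a b : a *: u + b *: v = 0 -> (a, b) = 0.
  move=> h; apply: (diffeo_derive_eq0 (p := p) fdiff).
  by rewrite derive_coord.
move: J0 ker; rewrite /jacobian -/u -/v; move: u v => [a b] [c d].
rewrite /det2 /= => J0 ker.
have scaleE (x y z w k l : R) :
  k *: (x, y) + l *: (z, w) = (k * x + l * z, k * y + l * w) by [].
(* A vanishing determinant gives two linear relations between the columns
   [(a, b)] and [(c, d)]; injectivity makes their coefficients vanish, so both
   columns are zero, which is a further relation. *)
have [c0 a0] : c = 0 /\ - a = 0.
  have /ker[] // : c *: (a, b) + (- a) *: (c, d) = 0.
  by rewrite scaleE; congr (_, _); lra.
have [d0 b0] : d = 0 /\ - b = 0.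
  have /ker[] // : d *: (a, b) + (- b) *: (c, d) = 0.
  by rewrite scaleE; congr (_, _); lra.
have /ker[/eqP] : 1 *: (a, b) + 0 *: (c, d) = 0.
  by rewrite scaleE; congr (_, _); lra.
by rewrite oner_eq0.
Qed.

Lemma derive1_comp_plane (R : realType) (f : R * R -> R * R) (L : R -> R * R) t :
  differentiable f (L t) -> derivable L t 1 ->
  (f \o L)^`() t = 'D_(L^`()%classic t) f (L t).
Proof.
move=> fd /derivable1_diffP Ld; rewrite !derive1E !deriveE//.
  exact: (congr1 (fun h => h 1) (diff_comp Ld fd)).
exact: differentiable_comp.
Qed.

Lemma derive1_comp_line (R : realType) (L : R -> R * R) (rho : R -> R) t :
  derivable rho t 1 -> derivable L (rho t) 1 ->
  (L \o rho)^`() t = rho^`()%classic t *: L^`()%classic (rho t).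
Proof.
move=> rd Ld; have /derivable1_diffP rd' := rd; have /derivable1_diffP Ld' := Ld.
rewrite !derive1E (deriveE (1 : R) (differentiable_comp rd' Ld')).
rewrite (deriveE (1 : R) rd') (deriveE (1 : R) Ld').
apply: etrans (congr1 (fun h => h 1) (diff_comp rd' Ld')) _ => /=.
have linE (c : R) : 'd L (rho t) c = c *: 'd L (rho t) 1.
  by rewrite -linearZ /GRing.scale /= mulr1.
exact: linE.
Qed.

(** * Increasing bijections of the line *)

Lemma increasing_bijection_continuous (R : realType) (rho rho' : R -> R) :
  cancel rho' rho -> {mono rho : s t / s <= t} -> continuous rho.
Proof.
move=> rho'K rho_mono t; have rho_lt := leW_mono rho_mono.
apply/cvgrPdist_lt => e e0.
have : t \in `]rho' (rho t - e), rho' (rho t + e)[%R.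
  rewrite in_itv/= -rho_lt rho'K -[X in _ && X]rho_lt rho'K.
  by apply/andP; split; lra.
move=> /near_in_itvoo; apply: filterS => u.
rewrite in_itv/= -rho_lt rho'K -[X in _ && X]rho_lt rho'K ltr_distlC.
by move=> /andP[? ?]; apply/andP; split; lra.
Qed.

Lemma increasing_bijection_pinfty (R : realType) (rho rho' : R -> R) :
  cancel rho' rho -> {mono rho : s t / s <= t} -> rho @ +oo --> +oo.
Proof.
move=> rho'K rho_mono; apply/cvgryPge => A.
near=> u; rewrite -(rho'K A) rho_mono; near: u.
exact: nbhs_pinfty_ge (num_real _).
Unshelve. all: by end_near. Qed.

Lemma increasing_bijection_ninfty (R : realType) (rho rho' : R -> R) :
  cancel rho' rho -> {mono rho : s t / s <= t} -> rho @ -oo --> -oo.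
Proof.
move=> rho'K rho_mono; apply/cvgrNyPle => A.
near=> u; rewrite -(rho'K A) rho_mono; near: u.
exact: nbhs_ninfty_le (num_real _).
Unshelve. all: by end_near. Qed.

Lemma reparametrization_mono (R : realType) (rho : R -> R) :
  reparametrization rho -> {mono rho : s t / s <= t}.
Proof.
case=> _ rd _ r0; apply: le_mono => s t st.
apply: (gtr0_derive1_incr (a := s) (b := t)) => //.
apply: continuous_subspaceT => u.
by apply: differentiable_continuous; exact/derivable1_diffP.
Qed.

(** * Turning of a nonvanishing vector field along the line *)

Definition angle_lift (R : realType) (V : R -> R * R) (theta : R -> R) :=
  continuous theta /\
  forall t, exists2 r : R, 0 < r & V t = (r * cos (theta t), r * sin (theta t)).

(** Counting turns by the limits at both ends, rather than by comparing the
    angles at [t] and [- t], makes the notion independent of the parameter. *)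
Definition turns (R : realType) (V : R -> R * R) (i : int) :=
  exists theta a, [/\ angle_lift V theta, theta @ -oo --> a &
    theta @ +oo --> a + i%:~R * (2 * pi)].

Lemma turns_reparam (R : realType) (V W : R -> R * R) (sigma sigma' k : R -> R)
    (i : int) :
  cancel sigma' sigma -> {mono sigma : s t / s <= t} ->
  (forall t, 0 < k t) -> (forall t, V t = k t *: W (sigma t)) ->
  turns W i -> turns V i.
Proof.
move=> sK smono k0 VE [theta [a [[tc tW] ta tb]]].
exists (theta \o sigma), a; split; first split.
- move=> t; apply: continuous_comp; last exact: tc.
  exact: increasing_bijection_continuous sK smono _.
- move=> t; have [r r0 WE] := tW (sigma t).
  exists (k t * r); first exact: mulr_gt0.
  by rewrite VE WE; congr (_, _); rewrite /= /GRing.scale/= mulrA.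
- exact: cvg_comp (increasing_bijection_ninfty sK smono) ta.
- exact: cvg_comp (increasing_bijection_pinfty sK smono) tb.
Qed.

Definition dot2 (R : realType) (u v : R * R) : R := u.1 * v.1 + u.2 * v.2.

Lemma dot2C (R : realType) (u v : R * R) : dot2 u v = dot2 v u.
Proof. by rewrite /dot2 mulrC [u.2 * _]mulrC. Qed.

Lemma dot2_gt0 (R : realType) (u : R * R) : u != 0 -> 0 < dot2 u u.
Proof.
case: u => a b; rewrite /dot2 /= => u0.
have a2 := sqr_ge0 a; have b2 := sqr_ge0 b; rewrite !expr2 in a2 b2.
rewrite lt_neqAle addr_ge0// andbT eq_sym paddr_eq0// !mulf_eq0 !orbb.
by apply: contra u0 => /andP[/eqP -> /eqP ->].
Qed.

(** [atan (det2 v w / dot2 v w)] is the oriented angle from [v] to [w] as long as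
    it is acute. *)
Lemma rotate_angle (R : realType) (v w : R * R) (th r : R) :
  0 < r -> v = (r * cos th, r * sin th) -> 0 < dot2 v w ->
  exists2 r', 0 < r' &
    let th' := th + atan (det2 v w / dot2 v w) in
    w = (r' * cos th', r' * sin th').
Proof.
move=> r0 -> d0; set d := dot2 _ _ in d0 *; set e := det2 _ _.
set al := atan _.
have c0 : 0 < cos al by apply: cos_gt0_pihalf; rewrite atan_gtNpi2 atan_ltpi2.
have sE : sin al = e / d * cos al.
  have := atanK (e / d); rewrite -/al /tan => <-.
  by rewrite divfK// gt_eqF.
(* [d / r] is the length of [w] times [cos al], as [r] is the length of [v]. *)
exists (d / (r * cos al)); first by rewrite divr_gt0// mulr_gt0.
have dn : d != 0 by rewrite gt_eqF.
have rn : r != 0 by rewrite gt_eqF.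
have cn : cos al != 0 by rewrite gt_eqF.
have := cos2Dsin2 th; rewrite !expr2 => cs1.
rewrite /= cosD sinD sE.
apply: injective_projections => /=.
  transitivity ((d * cos th - e * sin th) / r); last by field; rewrite cn rn dn.
  rewrite /d /e /dot2 /det2/=.
  transitivity (w.1 * (cos th * cos th + sin th * sin th)).
    by rewrite cs1 mulr1.
  by field.
transitivity ((d * sin th + e * cos th) / r); last by field; rewrite cn rn dn.
rewrite /d /e /dot2 /det2/=.
transitivity (w.2 * (cos th * cos th + sin th * sin th)).
  by rewrite cs1 mulr1.
by field.
Qed.

(** An angle function of [W] is that of [V] plus the acute angle from [V] to [W],
    and this correction vanishes near both ends. *)
Lemma turns_close (R : realType) (V W : R -> R * R) (i : int) :
  continuous V -> continuous W -> (forall s, 0 < dot2 (V s) (W s)) ->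
  (\forall s \near -oo, V s = W s) -> (\forall s \near +oo, V s = W s) ->
  turns V i -> turns W i.
Proof.
move=> Vc Wc VW0 VWl VWr [theta [a [[tc tV] ta tb]]].
pose q s := det2 (V s) (W s) / dot2 (V s) (W s); pose alpha s := atan (q s).
have qc : continuous q.
  move=> s; apply: cvgM.
    by apply: cvgB; apply: cvgM;
      [exact: continuous_fst_comp Vc s|exact: continuous_snd_comp Wc s
      |exact: continuous_snd_comp Vc s|exact: continuous_fst_comp Wc s].
  apply: cvgV; first by rewrite gt_eqF.
  by apply: cvgD; apply: cvgM;
    [exact: continuous_fst_comp Vc s|exact: continuous_fst_comp Wc s
    |exact: continuous_snd_comp Vc s|exact: continuous_snd_comp Wc s].
have ac : continuous alpha.
  by move=> s; exact: cvg_comp (qc s) (@continuous_atan R (q s)).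
have alpha0 s : V s = W s -> alpha s = 0.
  move=> E; rewrite /alpha /q E (_ : det2 _ _ = 0) ?mul0r ?atan0//.
  by rewrite /det2 mulrC subrr.
have acvg (F : set_system R) (b : R) : Filter F ->
    (\forall s \near F, V s = W s) ->
    theta @ F --> b -> (theta \+ alpha) @ F --> b.
  move=> FF VWF tb'; rewrite -[b]addr0; apply: cvgD => //.
  by apply: cvg_near_cst; apply: filterS VWF.
exists (theta \+ alpha), a; split; first split.
- by move=> s; apply: continuousD; [exact: tc|exact: ac].
- by move=> s; have [r r0 Vs] := tV s; exact: rotate_angle r0 Vs (VW0 s).
- exact: acvg.
- exact: acvg.
Qed.

(** * The index of a long curve *)

(** An angle function of a field pointing along the positive axis takes values in
    the discrete set of multiples of [2 * pi]. *)
Lemma axis_angle_constant (R : realType) (theta : R -> R) (s t : R) :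
  continuous theta -> s <= t ->
  (forall u, s <= u -> sin (theta u) = 0 /\ 0 < cos (theta u)) ->
  theta t = theta s.
Proof.
move=> tc st sc.
have key (f : R -> R) : continuous f ->
    (forall u, s <= u -> sin (f u) = 0 /\ 0 < cos (f u)) -> f t <= f s.
  move=> fc fsc; rewrite leNgt; apply/negP => fst.
  (* If [f] increased, it would take the value [f s + d], at which the sine
     is positive because [0 < d <= pi / 2]. *)
  pose d := Num.min (f t - f s) (pi / 2).
  have pi2 : 0 < pi / 2 :> R by rewrite divr_gt0// pi_gt0.
  have d0 : 0 < d by rewrite lt_min subr_gt0 fst.
  have dle : d <= f t - f s by rewrite ge_min lexx.
  have dle2 : d <= pi / 2 by rewrite ge_min lexx orbT.
  have [|c] := IVT (v := f s + d) st (continuous_subspaceT fc).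
    by rewrite ge_min le_max; apply/andP; split; apply/orP; [left|right]; lra.
  rewrite in_itv/= => /andP[sc' _] fcE.
  have [sin0 _] := fsc c sc'; have [sins0 coss0] := fsc s (lexx s).
  move: sin0; rewrite fcE sinD sins0 mul0r add0r => /eqP.
  rewrite mulf_eq0 gt_eqF//= gt_eqF//.
  have [->|dn] := eqVneq d (pi / 2); first by rewrite sin_pihalf.
  by apply: sin_gt0_pihalf; rewrite d0 lt_neqAle dn.
(* The reverse inequality is the same statement for the mirrored angle. *)
apply/eqP; rewrite eq_le key//=.
have : (- theta) t <= (- theta) s.
  apply: key; first by move=> u; apply: continuousN; exact: tc.
  by move=> u /sc; rewrite sinN cosN => -[-> ?]; rewrite oppr0.
by rewrite lerN2.
Qed.

Lemma derive1_snd_eq0 (R : realType) (L : R -> R * R) t :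
  derivable L t 1 -> (\forall u \near t, (L u).2 = 0) -> (L^`() t).2 = 0.
Proof.
move=> Ld L0; rewrite derive1E.
have Lc : h^-1 *: ((L \o shift t) (h *: 1) - L t) @[h --> 0^'] --> 'D_1 L t := Ld.
have L2c : (h^-1 *: ((L \o shift t) (h *: 1) - L t)).2 @[h --> 0^'] --> ('D_1 L t).2.
  by apply: (cvg_comp _ snd Lc); exact: cvg_snd.
apply: (norm_cvg_unique L2c).
have shc : h *: (1 : R) + t @[h --> 0^'] --> t.
  suff : h *: (1 : R) + t @[h --> (0 : R)] --> 0 *: (1 : R) + t.
    by rewrite scale0r add0r; exact: cvg_within_filter.
  by apply: cvgD; [apply: cvgZr_tmp; exact: cvg_id|exact: cvg_cst].
have L0' : \forall h \near (0 : R)^', (L (h *: (1 : R) + t)).2 = 0 := shc _ L0.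
apply: cvg_near_cst; apply: (filterS _ L0') => h /= ->.
by rewrite (nbhs_singleton L0) subrr scaler0.
Qed.

Lemma axis_angle_pinfty (R : realType) (L : R -> R * R) (theta : R -> R) :
  long_curve L -> is_tangent_angle L theta ->
  exists b, \forall t \near +oo, theta t = b.
Proof.
move=> hL [tc tL]; have [M [_ MP]] := long_curve_axis_right hL.
exists (theta (M + 1)); near=> t.
apply: axis_angle_constant; [exact: tc| |].
  by near: t; exact: nbhs_pinfty_ge (num_real _).
move=> u Mu; have {}Mu : M < u by lra.
have L2 : (L^`() u).2 = 0.
  apply: derive1_snd_eq0; first exact: long_curve_derivable hL _.
  have : u \in `]M, +oo[%R by rewrite in_itv/= andbT.
  by move=> /near_in_itvoy; apply: filterS => v; rewrite in_itv/= andbT => /MP[].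
have [_ L1] := MP u Mu; have [r r0 Lu] := tL u.
move: L1 L2; rewrite Lu /= pmulr_rgt0// => ? /eqP.
by rewrite mulf_eq0 gt_eqF//= => /eqP.
Unshelve. all: by end_near. Qed.

(** The reflection [t |-> - t] of the parameter exchanges the two ends. *)
Lemma axis_angle_ninfty (R : realType) (L : R -> R * R) (theta : R -> R) :
  long_curve L -> is_tangent_angle L theta ->
  exists b, \forall t \near -oo, theta t = b.
Proof.
move=> hL [tc tL]; have [M [_ MP]] := long_curve_axis_left hL.
pose theta' t := theta (- t).
have tc' : continuous theta'.
  by move=> t; apply: continuous_comp; [exact: opp_continuous|exact: tc].
exists (theta (M - 1)); near=> t.
rewrite -[t]opprK -[M - 1]opprK; apply: (@axis_angle_constant _ theta') => //.
  by rewrite lerN2; near: t; exact: nbhs_ninfty_le (num_real _).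
rewrite /theta' => u Mu; have {}Mu : - u < M by lra.
have L2 : (L^`() (- u)).2 = 0.
  apply: derive1_snd_eq0; first exact: long_curve_derivable hL _.
  have : - u \in `]-oo, M[%R by rewrite in_itv/=.
  by move=> /near_in_itvNyo; apply: filterS => v; rewrite in_itv/= => /MP[].
have [_ L1] := MP _ Mu; have [r r0 Lu] := tL (- u).
move: L1 L2; rewrite Lu /= pmulr_rgt0// => ? /eqP.
by rewrite mulf_eq0 gt_eqF//= => /eqP.
Unshelve. all: by end_near. Qed.

(** The angle being constant near each end, the variation between [- t] and [t]
    is eventually the difference of these two constants. *)
Lemma is_index_turns (R : realType) (L : R -> R * R) (i : int) :
  long_curve L -> is_index L i <-> turns L^`() i.
Proof.
move=> hL; split=> [[theta lift tlim]|[theta [a [lift ta tb]]]].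
  have [b tb] := axis_angle_pinfty hL lift.
  have [a ta] := axis_angle_ninfty hL lift.
  exists theta, a; split => //; first exact: cvg_near_cst.
  have taN : \forall t \near +oo, theta (- t) = a.
    have [M [_ MP]] := ta; exists (- M); split; first exact: num_real.
    by move=> t Mt; apply: MP; rewrite ltrNl.
  have -> : a + i%:~R * (2 * pi) = b.
    suff -> : i%:~R * (2 * pi) = b - a by rewrite addrC subrK.
    apply: (cvg_unique _ tlim) => //; apply: cvg_near_cst.
    by near=> t; congr (_ - _); near: t.
  exact: cvg_near_cst.
exists theta => //.
have taN : theta (- t) @[t --> +oo] --> a by move/cvgNy_compNP: ta.
have -> : i%:~R * (2 * pi) = a + i%:~R * (2 * pi) - a by rewrite addrAC subrr add0r.
exact: cvgB tb taN.
Unshelve. all: by end_near. Qed.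

(** * Ambient isotopies act on tangent vectors *)

Lemma isotopy_derive_continuous (R : realType) (phi : R -> R * R -> R * R) v :
  ambient_isotopy phi ->
  continuous (fun z : R * (R * R) => 'D_v (phi (clamp z.1)) z.2).
Proof.
by move=> hphi; exact: continuous_clamp (@isotopy_continuous_deriv _ _ hphi v).
Qed.

Lemma isotopy_differentiable (R : realType) (phi : R -> R * R -> R * R) t p :
  ambient_isotopy phi -> differentiable (phi (clamp t)) p.
Proof.
by move=> hphi; have [g [_ _ [+ _] _]] := isotopy_diffeo hphi (clamp_itv t); apply.
Qed.

Lemma isotopy_derive0 (R : realType) (phi : R -> R * R -> R * R) v p :
  ambient_isotopy phi -> 'D_v (phi (clamp 0)) p = v.
Proof.
move=> hphi; rewrite clamp_id ?lexx ?ler01// (isotopy_start hphi).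
exact: derive_id.
Qed.

(** In time the Jacobian at [p] is continuous, equal to 1 at the start, and never
    zero. *)
Lemma isotopy_jacobian_gt0 (R : realType) (phi : R -> R * R -> R * R) p :
  ambient_isotopy phi -> 0 < jacobian (phi 1) p.
Proof.
move=> hphi; pose J t := jacobian (phi (clamp t)) p.
have c v : continuous (fun t => 'D_v (phi (clamp t)) p).
  move=> t; apply: (@continuous_comp _ _ _ (fun t => (t, p))
    (fun z : R * (R * R) => 'D_v (phi (clamp z.1)) z.2)).
    by apply: (@cvg_pair _ _ _ (nbhs t) (nbhs t) (nbhs p));
      [exact: cvg_id|exact: cvg_cst].
  exact: isotopy_derive_continuous.
have Jc : continuous J.
  move=> t; apply: cvgB; apply: cvgM.
  - exact: continuous_fst_comp (c (1, 0)) t.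
  - exact: continuous_snd_comp (c (0, 1)) t.
  - exact: continuous_snd_comp (c (1, 0)) t.
  - exact: continuous_fst_comp (c (0, 1)) t.
have J0 : J 0 = 1 by rewrite /J /jacobian !isotopy_derive0// /det2/=; ring.
have J1 : J 1 = jacobian (phi 1) p by rewrite /J clamp_id ?lexx ?ler01.
rewrite -J1 ltNge; apply/negP => J1le.
have [|t _ /eqP] := IVT (v := 0) ler01 (continuous_subspaceT Jc).
  by rewrite J0 ge_min J1le orbT le_max ler01.
exact/negP/(diffeo_jacobian_neq0 _ (isotopy_diffeo hphi (clamp_itv t))).
Qed.

(** The complement of [K] is open, so the map is the identity near [p]. *)
Lemma isotopy_derive_support (R : realType) (phi : R -> R * R -> R * R)
    (K : set (R * R)) v p t :
  compact K -> (forall t p, 0 <= t <= 1 -> ~ K p -> phi t p = p) -> ~ K p ->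
  'D_v (phi (clamp t)) p = v.
Proof.
move=> Kc Kfix Kp; rewrite -[RHS](derive_id p v); apply: near_eq_derive.
have : open (~` K) by rewrite openC; apply: compact_closed Kc; exact: norm_hausdorff.
rewrite openE => /(_ _ Kp); apply: filterS => q Kq.
exact: Kfix (clamp_itv t) Kq.
Qed.

Lemma isotopy_derive_far (R : realType) (phi : R -> R * R -> R * R)
    (T : Type) (F : set_system T) (L : T -> R * R) :
  Filter F -> ambient_isotopy phi ->
  (forall M, \forall s \near F, M < `|(L s).1|) ->
  \forall s \near F, forall t v, 'D_v (phi (clamp t)) (L s) = v.
Proof.
move=> FF hphi Lfar; have [K Kc Kfix] := isotopy_support hphi.
have [M [_ MP]] := compact_bounded Kc.
apply: filterS (Lfar (M + 1)) => s sM t v.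
apply: isotopy_derive_support Kc Kfix _ => /(MP (M + 1)).
rewrite ltrDl ltr01 => /(_ isT); apply/negP; rewrite -ltNge.
by apply: lt_le_trans sM _; rewrite prod_normE le_max lexx.
Qed.

(** The tangent vector of the curve [phi (clamp t) \o L] at [s], written with the differential of [phi t] so that continuity in
    [t] and nonvanishing can be read off. *)
Definition push_tangent (R : realType) (phi : R -> R * R -> R * R)
    (L : R -> R * R) (t s : R) : R * R :=
  'D_(L^`()%classic s) (phi (clamp t)) (L s).

Lemma push_tangent_continuous (R : realType) (phi : R -> R * R -> R * R)
    (L : R -> R * R) :
  ambient_isotopy phi -> long_curve L ->
  continuous (fun z : R * R => push_tangent phi L z.1 z.2).
Proof.
move=> hphi hL.
have -> : (fun z : R * R => push_tangent phi L z.1 z.2) = fun z : R * R =>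
    (L^`() z.2).1 *: 'D_(1, 0) (phi (clamp z.1)) (L z.2) +
    (L^`() z.2).2 *: 'D_(0, 1) (phi (clamp z.1)) (L z.2).
  by apply/funext => z; exact: derive_coord (isotopy_differentiable _ _ hphi).
have Lc : continuous L.
  move=> s; apply: differentiable_continuous; apply/derivable1_diffP.
  exact: long_curve_derivable hL s.
have Dc v : continuous (fun z : R * R => 'D_v (phi (clamp z.1)) (L z.2)).
  move=> z; apply: (@continuous_comp _ _ _ (fun z : R * R => (z.1, L z.2))
    (fun z : R * (R * R) => 'D_v (phi (clamp z.1)) z.2)); last first.
    exact: isotopy_derive_continuous.
  apply: (@cvg_pair _ _ _ (nbhs z) (nbhs z.1) (nbhs (L z.2))).
    exact: cvg_fst.
  by apply: (@cvg_comp _ _ _ snd L _ (nbhs z.2)); [exact: cvg_snd|exact: Lc].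
have L'c : continuous (fun z : R * R => L^`() z.2).
  move=> z; apply: (@cvg_comp _ _ _ snd L^`() _ (nbhs z.2)); first exact: cvg_snd.
  exact: long_curve_C1 hL _.
move=> z; apply: cvgD; apply: cvgZ.
- exact: continuous_fst_comp L'c z.
- exact: Dc.
- exact: continuous_snd_comp L'c z.
- exact: Dc.
Qed.

Lemma push_tangent_neq0 (R : realType) (phi : R -> R * R -> R * R)
    (L : R -> R * R) t s :
  ambient_isotopy phi -> long_curve L -> push_tangent phi L t s != 0.
Proof.
move=> hphi hL.
apply: contra_neq (long_curve_immersion hL s).
exact: diffeo_derive_eq0 (isotopy_diffeo hphi (clamp_itv t)).
Qed.

Lemma push_tangent_pinfty (R : realType) (phi : R -> R * R -> R * R)
    (L : R -> R * R) :
  ambient_isotopy phi -> long_curve L ->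
  \forall s \near +oo, forall t, push_tangent phi L t s = L^`() s.
Proof.
move=> hphi hL.
have far M : \forall s \near +oo, M < `|(L s).1|.
  have /cvgryPgt/(_ M) := long_curve_right_end hL.
  by apply: filterS => s /lt_le_trans; apply; exact: ler_norm.
by apply: filterS (isotopy_derive_far _ hphi far) => s fixed t; exact: fixed.
Qed.

Lemma push_tangent_ninfty (R : realType) (phi : R -> R * R -> R * R)
    (L : R -> R * R) :
  ambient_isotopy phi -> long_curve L ->
  \forall s \near -oo, forall t, push_tangent phi L t s = L^`() s.
Proof.
move=> hphi hL.
have far M : \forall s \near -oo, M < `|(L s).1|.
  have /cvgrNyPlt/(_ (- M)) := long_curve_left_end hL.
  apply: filterS => s; rewrite ltrNr => /lt_le_trans; apply.
  by rewrite -normrN ler_norm.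
by apply: filterS (isotopy_derive_far _ hphi far) => s fixed t; exact: fixed.
Qed.

(** For [s] outside a bounded interval both vectors equal [L^`() s]. Inside, the scalar product is
    positive at time [t0], hence for [(s, t)] near each [(s, t0)], and compactness
    makes the neighbourhood of [t0] independent of [s]. *)
Lemma push_tangent_close (R : realType) (phi : R -> R * R -> R * R)
    (L : R -> R * R) t0 :
  ambient_isotopy phi -> long_curve L ->
  \forall t \near t0, forall s,
    0 < dot2 (push_tangent phi L t0 s) (push_tangent phi L t s).
Proof.
move=> hphi hL; pose V := push_tangent phi L.
have [b [_ bP]] := push_tangent_pinfty hphi hL.
have [a [_ aP]] := push_tangent_ninfty hphi hL.
have /compact_near_coveringP cov := @segment_compact R a b.
pose D (z : R * R) := dot2 (V t0 z.1) (V z.2 z.1).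
have Vc (f : R * R -> R * R) : continuous f -> continuous (fun z => V (f z).1 (f z).2).
  move=> fc z; apply: (@continuous_comp _ _ _ f (fun z : R * R => V z.1 z.2)).
    exact: fc.
  exact: push_tangent_continuous hphi hL _.
have Dc : continuous D.
  have c1 : continuous (fun z : R * R => V t0 z.1).
    apply: (Vc (fun z => (t0, z.1))) => z.
    by apply: (@cvg_pair _ _ _ (nbhs z) (nbhs t0) (nbhs z.1));
      [exact: cvg_cst|exact: cvg_fst].
  have c2 : continuous (fun z : R * R => V z.2 z.1).
    apply: (Vc (fun z => (z.2, z.1))) => z.
    by apply: (@cvg_pair _ _ _ (nbhs z) (nbhs z.2) (nbhs z.1));
      [exact: cvg_snd|exact: cvg_fst].
  move=> z; apply: cvgD; apply: cvgM.
  - exact: continuous_fst_comp c1 z.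
  - exact: continuous_fst_comp c2 z.
  - exact: continuous_snd_comp c1 z.
  - exact: continuous_snd_comp c2 z.
have : \forall t \near t0, `[a, b] `<=` (fun s => 0 < dot2 (V t0 s) (V t s)).
  apply: (cov R (nbhs t0) (fun t s => 0 < dot2 (V t0 s) (V t s)) _).
  move=> s _.
  have D0 : 0 < D (s, t0) by exact/dot2_gt0/(push_tangent_neq0 _ _ hphi hL).
  exact: cvgr_gt (Dc (s, t0)) _ D0.
apply: filterS => t tP s.
have [/bP bE|sb] := ltP b s.
  by rewrite !bE; apply: dot2_gt0; exact: long_curve_immersion.
have [/aP aE|sa] := ltP s a.
  by rewrite !aE; apply: dot2_gt0; exact: long_curve_immersion.
by apply: tP; rewrite /= in_itv/= sa sb.
Qed.

Lemma push_tangent_turns (R : realType) (phi : R -> R * R -> R * R)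
    (L : R -> R * R) (s t : R) (i : int) :
  ambient_isotopy phi -> long_curve L ->
  turns (push_tangent phi L s) i -> turns (push_tangent phi L t) i.
Proof.
move=> hphi hL; pose V := push_tangent phi L.
apply: (@locally_constant_prop R (fun t => turns (V t) i)) => t0.
apply: filterS (push_tangent_close t0 hphi hL) => u close.
have Vc t1 : continuous (V t1).
  move=> x; apply: (@continuous_comp _ _ _ (fun x => (t1, x))
    (fun z : R * R => V z.1 z.2)); last exact: push_tangent_continuous hphi hL _.
  by apply: (@cvg_pair _ _ _ (nbhs x) (nbhs t1) (nbhs x));
    [exact: cvg_cst|exact: cvg_id].
have l t1 t2 : \forall x \near -oo, V t1 x = V t2 x.
  by apply: filterS (push_tangent_ninfty hphi hL) => x E; rewrite /V !E.
have r t1 t2 : \forall x \near +oo, V t1 x = V t2 x.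
  by apply: filterS (push_tangent_pinfty hphi hL) => x E; rewrite /V !E.
split; [apply: turns_close (Vc u) (Vc t0) _ (l _ _) (r _ _)
       |apply: turns_close (Vc t0) (Vc u) _ (l _ _) (r _ _)] => x.
  by rewrite dot2C; exact: close.
exact: close.
Qed.

(** * Invariance of signs and of the index *)

Lemma double_point_sign_conj (R : realType) (psi : R * R -> R * R)
    (rho rho' : R -> R) (L L' : R -> R * R) A :
  injective psi -> cancel rho' rho -> {mono rho : s t / s <= t} ->
  (forall t, L' (rho t) = psi (L t)) ->
  (forall s t, L s = L t -> (det2 (L'^`() (rho s)) (L'^`() (rho t)) < 0) =
                            (det2 (L^`() s) (L^`() t) < 0)) ->
  double_point_sign L' (psi A) = double_point_sign L A.
Proof.
move=> psiI rho'K rho_mono LE dE; have rho_lt := leW_mono rho_mono.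
apply: (congr1 (fun b : bool => if b then 1 else -1 : int)).
apply: asbool_equiv_eq; split=> [[s [t []]]|[s [t [st Ls Lt d0]]]].
  rewrite -(rho'K s) -(rho'K t) rho_lt !LE => st /psiI Ls /psiI Lt d0.
  exists (rho' s), (rho' t); split; [exact: st|exact: Ls|exact: Lt|].
  exact: etrans (esym (dE _ _ (etrans Ls (esym Lt)))) d0.
exists (rho s), (rho t).
split; [by rewrite rho_lt|by rewrite LE Ls|by rewrite LE Lt|].
exact: etrans (dE _ _ (etrans Ls (esym Lt))) d0.
Qed.

Lemma isotopic_tangent (R : realType) (phi : R -> R * R -> R * R) (rho : R -> R)
    (L L' : R -> R * R) t :
  ambient_isotopy phi -> reparametrization rho ->
  long_curve L -> long_curve L' -> (forall t, phi 1 (L t) = L' (rho t)) ->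
  'D_(L^`()%classic t) (phi 1) (L t) =
  rho^`()%classic t *: L'^`()%classic (rho t).
Proof.
move=> hphi hrho hL hL' LE; have [_ rd _ _] := hrho.
rewrite -derive1_comp_plane; last exact: long_curve_derivable hL t.
  rewrite -(derive1_comp_line (rd t) (@long_curve_derivable _ _ hL' _)).
  by congr (_^`() t)%classic; apply/funext => s; exact: LE.
by have := isotopy_differentiable 1 (L t) hphi; rewrite clamp_id ?lexx ?ler01.
Qed.

(** Both tangents at the double point are mapped by one differential, of positive
    determinant, and then divided by the positive speeds of [rho]. *)
Lemma det2_isotopic (R : realType) (phi : R -> R * R -> R * R) (rho : R -> R)
    (L L' : R -> R * R) s t :
  ambient_isotopy phi -> reparametrization rho ->
  long_curve L -> long_curve L' -> (forall t, phi 1 (L t) = L' (rho t)) ->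
  L s = L t ->
  (det2 (L'^`() (rho s)) (L'^`() (rho t)) < 0) = (det2 (L^`() s) (L^`() t) < 0).
Proof.
move=> hphi hrho hL hL' LE Lst; have [_ _ _ r0] := hrho.
have d1 : differentiable (phi 1) (L t).
  by have := isotopy_differentiable 1 (L t) hphi; rewrite clamp_id ?lexx ?ler01.
have J0 := isotopy_jacobian_gt0 (L t) hphi.
have Ds : 'D_(L^`()%classic s) (phi 1) (L t) =
    rho^`()%classic s *: L'^`()%classic (rho s).
  by rewrite -Lst; exact: isotopic_tangent hphi hrho hL hL' LE.
have scale2 (k l : R) (u v : R * R) :
    det2 (k *: u) (l *: v) = (k * l) * det2 u v.
  by case: u v => [a b] [c d]; rewrite /det2 /= /GRing.scale /=; ring.
have E := etrans (esym (det2_derive (L^`()%classic s) (L^`()%classic t) d1))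
  (etrans (congr2 (@det2 R) Ds (isotopic_tangent t hphi hrho hL hL' LE))
    (scale2 _ _ _ _)).
have same_sign (j k d d' : R) :
    0 < j -> 0 < k -> j * d = k * d' -> (d' < 0) = (d < 0).
  by move=> j0 k0 jk; rewrite -(pmulr_rlt0 d' k0) -jk pmulr_rlt0.
exact: same_sign J0 (mulr_gt0 (r0 s) (r0 t)) E.
Qed.

Lemma isotopic_turns (R : realType) (phi : R -> R * R -> R * R) (rho : R -> R)
    (L L' : R -> R * R) (i : int) :
  ambient_isotopy phi -> reparametrization rho ->
  long_curve L -> long_curve L' -> (forall t, phi 1 (L t) = L' (rho t)) ->
  turns L^`() i <-> turns L'^`() i.
Proof.
move=> hphi hrho hL hL' LE; have [[rho' rhoK rho'K] _ _ r0] := hrho.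
have rho_mono := reparametrization_mono hrho.
have V0 : push_tangent phi L 0 = L^`() by apply/funext => s; exact: isotopy_derive0.
have V1 s : push_tangent phi L 1 s = rho^`()%classic s *: L'^`()%classic (rho s).
  rewrite /push_tangent (_ : clamp 1 = 1).
    exact: isotopic_tangent hphi hrho hL hL' LE.
  by rewrite clamp_id ?lexx ?ler01.
suff : turns (push_tangent phi L 0) i <-> turns L'^`() i by rewrite V0.
split=> [/(push_tangent_turns 1 hphi hL) h|h].
  apply: (turns_reparam (sigma := rho') (sigma' := rho)
    (k := fun t => (rho^`()%classic (rho' t))^-1)) h.
  - exact: rhoK.
  - by move=> s t; rewrite -rho_mono !rho'K.
  - by move=> t; rewrite invr_gt0.
  - by move=> t; rewrite V1 rho'K scalerA mulVf ?scale1r// gt_eqF.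
apply: (push_tangent_turns (s := 1) _ hphi hL).
exact: (turns_reparam rho'K rho_mono r0 V1).
Qed.

Theorem theorem4p3 (R : realType) (K : comNzRingType)
    (x1 x2 x3 x4 x5 x6 x7 x8 x9 x10 x11 x12 x13 x14 x15 : K)
    (L L' : R -> R * R) (hL : long_curve L) (hL' : long_curve L')
    (hiso : plane_isotopic L L') :
  LI3 L x1 x2 x3 x4 x5 x6 x7 x8 x9 x10 x11 x12 x13 x14 x15 =
  LI3 L' x1 x2 x3 x4 x5 x6 x7 x8 x9 x10 x11 x12 x13 x14 x15.
Proof.
have [phi [rho [hphi hrho LE]]] := hiso.
have [[rho' rhoK rho'K] _ _ _] := hrho.
have rho_mono := reparametrization_mono hrho.
have [|psi' [psiK psi'K _ _]] := isotopy_diffeo hphi (t := 1).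
  by rewrite lexx ler01.
have LE' t := esym (LE t).
have signE A : double_point_sign L' (phi 1 A) = double_point_sign L A.
  apply: double_point_sign_conj (can_inj psiK) rho'K rho_mono LE' _.
  by move=> s t; exact: (det2_isotopic hphi hrho hL hL' LE).
have pairE (c : seq (K * seq nat)) : pairing c L' = pairing c L.
  rewrite /pairing; apply: eq_bigr => cv _.
  rewrite (gauss_word_conj (can_inj psiK) rhoK rho'K rho_mono LE').
  apply: (congr1 (fun n : int => cv.1 * n%:~R)).
  exact: word_pairing_map psiK psi'K signE.
have indexE : curve_index L' = curve_index L.
  apply: (congr1 (xget 0)); apply/seteqP; split=> i h.
    exact: (is_index_turns i hL).2 ((isotopic_turns i hphi hrho hL hL' LE).2
      ((is_index_turns i hL').1 h)).
  exact: (is_index_turns i hL').2 ((isotopic_turns i hphi hrho hL hL' LE).1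
    ((is_index_turns i hL).1 h)).
by rewrite /LI3 !pairE indexE.
Qed.
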